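(* Let $\ell$ be an odd prime, let $t\ge2$ and $k>1$ be integers, and let $X_t$ be the bouquet with $t$ loops. Assume that $2k-1<\ell$ and $k(k-1)<t$. Then $$\mathrm{Prob}_\ell(X_t;\mu=0,\lambda<2k-1)\le(1-\ell^{-t})^{-1}\big(1-\ell^{-k(k-1)}\big).$$
   Context: For $b\in\mathbb{Z}_\ell$ put $\binom{b}{n}=\frac{b(b-1)\cdots(b-n+1)}{n!}\in\mathbb{Z}_\ell$ and $(1+T)^b=\sum_{n\ge0}\binom{b}{n}T^n\in\mathbb{Z}_\ell[[T]]$. The bouquet $X_t$ is the multigraph with one vertex and $t$ undirected loops; a vector $\alpha=(\alpha_1,\dots,\alpha_t)\in\mathbb{Z}_\ell^t$ assigns the voltage $\alpha_j$ to the $j$-th loop. It is admissible if $\alpha\in\mathbb{Z}_\ell^t\setminus(\ell\mathbb{Z}_\ell)^t$. The characteristic series is $$f(T)=f_{X_t,\alpha}(T)=\sum_{j=1}^t\big(2-(1+T)^{\alpha_j}-(1+T)^{-\alpha_j}\big)\in\mathbb{Z}_\ell[[T]].$$ For admissible $\alpha$ it is nonzero, and it has zero constant term. By Weierstrass preparation write $f(T)=\ell^{\mu}g(T)u(T)$ with $\mu\in\mathbb{Z}_{\ge0}$, $g$ a distinguished polynomial (monic, all non-leading coefficients divisible by $\ell$) and $u\in\mathbb{Z}_\ell[[T]]^\times$. Then $\mu_\ell(X_t,\alpha):=\mu$ and $\lambda_\ell(X_t,\alpha):=\deg g-1$ (note the shift by $-1$). Let $\tau$ be the Haar measure on $\mathbb{Z}_\ell^t$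 normalized by $\tau(\mathbb{Z}_\ell^t)=1$, so $\tau(\mathbb{Z}_\ell^t\setminus(\ell\mathbb{Z}_\ell)^t)=1-\ell^{-t}$. Define $$\mathrm{Prob}_\ell(X_t;\mu=0,\lambda<2k-1)=(1-\ell^{-t})^{-1}\,\tau\big(\{\alpha\in\mathbb{Z}_\ell^t\setminus(\ell\mathbb{Z}_\ell)^t:\mu_\ell(X_t,\alpha)=0,\ \lambda_\ell(X_t,\alpha)<2k-1\}\big).$$ *)

(* Defs.v *)
From HB Require Import structures.
From mathcomp Require Import all_boot all_order all_algebra.
From mathcomp Require Import all_classical all_reals all_analysis.

Set Implicit Arguments.
Unset Strict Implicit.
Unset Printing Implicit Defensive.

Import Order.TTheory GRing.Theory Num.Theory.

Local Open Scope classical_set_scope.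
Local Open Scope ring_scope.

(* The ring of l-adic integers, as the inverse limit of the rings Z/l^(n+1).
   The index is shifted because 'Z_1 denotes Z/2 in MathComp.  All that follows
   is meant for 1 < l, although the ring structure exists for every l. *)

Definition Zp_red l n (x : 'Z_(l ^ n.+2)) : 'Z_(l ^ n.+1) := inZp x.

Record padic (l : nat) := Padic {
  approx :> forall n, 'Z_(l ^ n.+1);
  approxP : forall n, Zp_red (approx n.+1) = approx n
}.

Section PadicRing.
Variable l : nat.

Lemma Zp_red_dvd n : ((Zp_trunc (l ^ n.+1)).+2 %| (Zp_trunc (l ^ n.+2)).+2)%N.
Proof.
case: l => [|[|m]]; rewrite ?exp0n ?exp1n //.
by rewrite !Zp_cast ?dvdn_exp2l //; apply: (@leq_trans (m.+2 ^ 1)%N);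
   rewrite ?leq_exp2l.
Qed.

Lemma Zp_redD n : {morph @Zp_red l n : x y / x + y}.
Proof.
move=> x y; apply: val_inj => /=.
by rewrite modn_dvdm ?Zp_red_dvd // modnDm.
Qed.

Lemma Zp_redM n : {morph @Zp_red l n : x y / x * y}.
Proof.
move=> x y; apply: val_inj => /=.
by rewrite modn_dvdm ?Zp_red_dvd // modnMm.
Qed.

Lemma Zp_red1 n : Zp_red 1 = 1 :> 'Z_(l ^ n.+1).
Proof. by apply: val_inj; rewrite /= !modn_small. Qed.

Lemma Zp_red0 n : Zp_red 0 = 0 :> 'Z_(l ^ n.+1).
Proof. by apply: val_inj; rewrite /= !mod0n. Qed.

Lemma Zp_redN n : {morph @Zp_red l n : x / - x}.
Proof.
by move=> x; apply/eqP; rewrite -addr_eq0 -Zp_redD addNr Zp_red0.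
Qed.

Lemma padic_ext (x y : padic l) : (forall n, x n = y n) -> x = y.
Proof.
case: x y => [x xP] [y yP] /= xy.
have {}xy : x = y by apply: functional_extensionality_dep.
by case: _ / xy yP => yP; congr Padic; apply: Prop_irrelevance.
Qed.

Fact padic0_subproof n : Zp_red 0 = 0 :> 'Z_(l ^ n.+1).
Proof. exact: Zp_red0. Qed.
Fact padic1_subproof n : Zp_red 1 = 1 :> 'Z_(l ^ n.+1).
Proof. exact: Zp_red1. Qed.
Fact padicN_subproof (x : padic l) n : Zp_red (- x n.+1) = - x n.
Proof. by rewrite Zp_redN approxP. Qed.
Fact padicD_subproof (x y : padic l) n : Zp_red (x n.+1 + y n.+1) = x n + y n.
Proof. by rewrite Zp_redD !approxP. Qed.
Fact padicM_subproof (x y : padic l) n : Zp_red (x n.+1 * y n.+1) = x n * y n.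
Proof. by rewrite Zp_redM !approxP. Qed.

Definition padic0 := @Padic l (fun=> 0) padic0_subproof.
Definition padic1 := @Padic l (fun=> 1) padic1_subproof.
Definition padicN (x : padic l) := @Padic l (fun n => - x n) (padicN_subproof x).
Definition padicD (x y : padic l) := @Padic l (fun n => x n + y n) (padicD_subproof x y).
Definition padicM (x y : padic l) := @Padic l (fun n => x n * y n) (padicM_subproof x y).

HB.instance Definition _ := gen_eqMixin (padic l).
HB.instance Definition _ := gen_choiceMixin (padic l).

Fact padicDA : associative padicD.
Proof. by move=> x y z; apply: padic_ext => n; apply: addrA. Qed.
Fact padicDC : commutative padicD.
Proof. by move=> x y; apply: padic_ext => n; apply: addrC. Qed.
Fact padicD0 : left_id padic0 padicD.
Proof. by move=> x; apply: padic_ext => n; apply: add0r. Qed.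
Fact padicDN : left_inverse padic0 padicN padicD.
Proof. by move=> x; apply: padic_ext => n; apply: addNr. Qed.

HB.instance Definition _ :=
  GRing.isZmodule.Build (padic l) padicDA padicDC padicD0 padicDN.

Fact padicMA : associative padicM.
Proof. by move=> x y z; apply: padic_ext => n; apply: mulrA. Qed.
Fact padicMC : commutative padicM.
Proof. by move=> x y; apply: padic_ext => n; apply: mulrC. Qed.
Fact padicM1 : left_id padic1 padicM.
Proof. by move=> x; apply: padic_ext => n; apply: mul1r. Qed.
Fact padicMD : left_distributive padicM padicD.
Proof. by move=> x y z; apply: padic_ext => n; apply: mulrDl. Qed.
Fact padic1_neq0 : padic1 != padic0.
Proof.
by apply/eqP => /(congr1 (fun x : padic l => x 0)) /eqP; rewrite oner_eq0.
Qed.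

HB.instance Definition _ := GRing.Zmodule_isComNzRing.Build (padic l)
  padicMA padicMC padicM1 padicMD padic1_neq0.

HB.instance Definition _ := isPointed.Build (padic l) 0.

HB.instance Definition _ := Topological.copy (padic l)
  (initial_topology (@approx l :
     padic l -> prod_topology (fun n => discrete_topology 'Z_(l ^ n.+1)))).

End PadicRing.

Definition padic_dvd l (x : padic l) : Prop := exists c, x = l%:R * c.

(* b(b-1)...(b-n+1)/n! : for l prime the quotient exists and is unique. *)
Definition padic_bin l (b : padic l) (n : nat) : padic l :=
  xget 0 [set c | n`!%:R * c = \prod_(i < n) (b - i%:R)].

Record fps (R : Type) := Fps { fps_coef :> nat -> R }.

Section FpsRing.
Variable R : comNzRingType.
Implicit Types f g h : fps R.

Lemma fps_ext f g : (forall n, f n = g n) -> f = g.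
Proof. by case: f g => [f] [g] /= fg; congr Fps; apply: funext. Qed.

HB.instance Definition _ := gen_eqMixin (fps R).
HB.instance Definition _ := gen_choiceMixin (fps R).

Definition fps_poly (p : {poly R}) : fps R := Fps (fun n => p`_n).

Definition fps0 : fps R := Fps (fun=> 0).
Definition fpsN f := Fps (fun n => - f n).
Definition fpsD f g := Fps (fun n => f n + g n).
Definition fpsM f g := Fps (fun n => \sum_(i < n.+1) f i * g (n - i)%N).

Fact fpsDA : associative fpsD.
Proof. by move=> f g h; apply: fps_ext => n; apply: addrA. Qed.
Fact fpsDC : commutative fpsD.
Proof. by move=> f g; apply: fps_ext => n; apply: addrC. Qed.
Fact fpsD0 : left_id fps0 fpsD.
Proof. by move=> f; apply: fps_ext => n; apply: add0r. Qed.
Fact fpsDN : left_inverse fps0 fpsN fpsD.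
Proof. by move=> f; apply: fps_ext => n; apply: addNr. Qed.

HB.instance Definition _ :=
  GRing.isZmodule.Build (fps R) fpsDA fpsDC fpsD0 fpsDN.

Definition fps_trunc n f : {poly R} := \poly_(i < n.+1) f i.

Lemma coef_fps_trunc n f i : (i <= n)%N -> (fps_trunc n f)`_i = f i.
Proof. by move=> le_in; rewrite coef_poly ltnS le_in. Qed.

Lemma fpsM_trunc n f g i : (i <= n)%N ->
  fpsM f g i = (fps_trunc n f * fps_trunc n g)`_i.
Proof.
move=> le_in; rewrite coefM; apply: eq_bigr => j _.
have le_ji : (j <= i)%N by rewrite -ltnS.
rewrite !coef_fps_trunc ?(leq_trans le_ji) //.
by rewrite (leq_trans (leq_subr _ _)).
Qed.

Fact fpsMA : associative fpsM.
Proof.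
move=> f g h; apply: fps_ext => n.
transitivity ((fps_trunc n f * (fps_trunc n g * fps_trunc n h))`_n).
  rewrite coefM; apply: eq_bigr => i _.
  have le_in : (i <= n)%N by rewrite -ltnS.
  by rewrite coef_fps_trunc // -fpsM_trunc // leq_subr.
rewrite mulrA coefM; apply: eq_bigr => i _.
have le_in : (i <= n)%N by rewrite -ltnS.
by rewrite coef_fps_trunc ?leq_subr // -fpsM_trunc.
Qed.
Fact fpsMC : commutative fpsM.
Proof. by move=> f g; apply: fps_ext => n; rewrite !(@fpsM_trunc n) // mulrC. Qed.
Fact fpsM1 : left_id (fps_poly 1) fpsM.
Proof.
move=> f; apply: fps_ext => n /=.
rewrite big_ord_recl /= coef1 eqxx mul1r subn0 big1 ?addr0 // => i _.
by rewrite coef1 mul0r.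
Qed.
Fact fpsMD : left_distributive fpsM fpsD.
Proof.
move=> f g h; apply: fps_ext => n /=.
by rewrite -big_split; apply: eq_bigr => i _; rewrite mulrDl.
Qed.
Fact fps1_neq0 : fps_poly 1 != 0.
Proof.
apply/eqP => /(congr1 (fun f : fps R => f 0)) /eqP.
by rewrite /= coef1 oner_eq0.
Qed.

HB.instance Definition _ := GRing.Zmodule_isComNzRing.Build (fps R)
  fpsMA fpsMC fpsM1 fpsMD fps1_neq0.

End FpsRing.

(* (1 + T)^b *)
Definition fps_pow1T l (b : padic l) : fps (padic l) := Fps (padic_bin b).

Section Invariants.
Variable l : nat.

Definition distinguished (g : {poly padic l}) : Prop :=
  g \is monic /\ forall i, (i < (size g).-1)%N -> padic_dvd g`_i.

Definition weierstrass (f : fps (padic l)) :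
    set (nat * {poly padic l} * fps (padic l)) :=
  [set w | let: (m, g, u) := w in
    [/\ distinguished g, exists v, u * v = 1
      & f = (l ^ m)%:R * fps_poly g * u]].

(* For l prime the decomposition exists and is unique unless f = 0, so the
   default value is only taken at f = 0, where mu is infinite by convention;
   it is chosen with mu <> 0. *)
Definition weierstrass_dec f := xget (1%N, 1, 1) (weierstrass f).

Definition fps_mu f : nat := (weierstrass_dec f).1.1.
Definition fps_deg f : nat := (size (weierstrass_dec f).1.2).-1.

Variable t : nat.
Implicit Type alpha : 'rV[padic l]_t.

Definition admissible alpha : Prop := ~ forall j, padic_dvd (alpha 0 j).

Definition bouquet_series alpha : fps (padic l) :=
  \sum_(j < t) (2 - fps_pow1T (alpha 0 j) - fps_pow1T (- alpha 0 j)).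

Definition mu_bouquet alpha : nat := fps_mu (bouquet_series alpha).
Definition lambda_bouquet alpha : int :=
  (fps_deg (bouquet_series alpha))%:Z - 1.

End Invariants.

Definition borelType (T : ptopologicalType) := g_sigma_algebraType (@open T).

Section Probability.
Variables (R : realType) (l t : nat).
Implicit Type tau : {measure set (borelType 'rV[padic l]_t) -> \bar R}.

(* The Borel measures on Z_l^t satisfying this are exactly the normalized Haar
   measure. *)
Definition normalized_haar tau : Prop :=
  tau setT = 1%E /\
  forall (x : 'rV[padic l]_t) (A : set (borelType 'rV[padic l]_t)),
    measurable A -> tau [set x + a | a in A] = tau A.

(* Prob_l(X_t; mu = m, lambda < b) *)
Definition Prob_bouquet tau (m : nat) (b : int) : \bar R :=
  ((1 - l%:R ^- t)^-1)%:E *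
  tau [set alpha : 'rV[padic l]_t |
    [/\ admissible alpha, mu_bouquet alpha = m & (lambda_bouquet alpha < b)%R]].

End Probability.

(* Main.v *)
(* Modulo l the first 2k coefficients of the characteristic series only depend on
   the residues of the voltages: since (1+T)^a + (1+T)^-a is even in a, and the
   factorials of the indices are units because 2k - 1 < l, they all vanish modulo l
   if and only if the power sums of the residues with exponents 2, 4, ..., 2k - 2
   all vanish.  So mu = 0 and lambda < 2k - 1 exactly when some of these power sums
   is nonzero.  They have total degree k(k - 1), so by Warning's second theorem they
   have at least l^(t - k(k - 1)) common zeros in F_l^t, and each residue class has
   Haar measure l^-t.

   Weierstrass preparation (its existence part) is needed to know that the event is
   exactly a union of residue classes, hence measurable.

   Warning's second theorem follows from the lower bound q^(n - m/(q-1)) on the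
   number of nonzeros of a nonzero polynomial function of degree at most m on F_q^n,
   proved by induction on n after dividing out the hyperplanes x_0 = c on which the
   function vanishes. *)

From HB Require Import structures.
Require Import Defs.
From mathcomp Require Import all_boot all_order all_algebra.
From mathcomp Require Import all_classical all_reals all_analysis.
From mathcomp Require Import finfield zify ring.
Import Order.TTheory GRing.Theory Num.Theory.
Local Open Scope ring_scope.

Set Implicit Arguments.
Unset Strict Implicit.
Unset Printing Implicit Defensive.

(** * Warning's second theorem *)

Section Warning.
Variable F : finFieldType.
Implicit Types (f g h : seq F -> F) (s : seq F) (m n : nat) (c y : F).

(** Polynomial functions of total degree less than [m]. The strict bound makes bound 0 mean the zero
    function, and arguments in [seq F] allow fixing a coordinate without changing the type. *)
Inductive deg_lt : nat -> (seq F -> F) -> Prop :=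
| deg_lt0 m : deg_lt m (fun=> 0)
| deg_ltC m c : deg_lt m.+1 (fun=> c)
| deg_ltD m f g : deg_lt m f -> deg_lt m g -> deg_lt m (fun s => f s + g s)
| deg_ltX m i f : deg_lt m f -> deg_lt m.+1 (fun s => s`_i * f s).

Lemma deg_lt0P f : deg_lt 0 f -> forall s, f s = 0.
Proof.
move Em : 0%N => m df; elim: df Em => {m f} // m f g _ IHf _ IHg Em s.
by rewrite IHf // IHg // addr0.
Qed.

Lemma deg_lt_eq m f g : deg_lt m f -> f =1 g -> deg_lt m g.
Proof. by move=> df /funext <-. Qed.

Lemma deg_ltW m n f : (m <= n)%N -> deg_lt m f -> deg_lt n f.
Proof.
move=> le_mn df; elim: df n le_mn => {m f} [m|m c|m f g _ IHf _ IHg|m i f _ IH] n.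
- by constructor.
- by case: n => // n _; constructor.
- by move=> le_mn; constructor; auto.
- by case: n => // n le_mn; constructor; auto.
Qed.

Lemma deg_ltZ m c f : deg_lt m f -> deg_lt m (fun s => c * f s).
Proof.
elim=> {m f} [m|m a|m f g _ IHf _ IHg|m i f _ IH].
- by apply: deg_lt_eq (deg_lt0 m) _ => s; rewrite mulr0.
- exact: deg_ltC.
- by apply: deg_lt_eq (deg_ltD IHf IHg) _ => s; rewrite mulrDr.
- by apply: deg_lt_eq (deg_ltX i IH) _ => s; rewrite mulrCA.
Qed.

Lemma deg_ltM m n f g :
  deg_lt m.+1 f -> deg_lt n.+1 g -> deg_lt (m + n).+1 (fun s => f s * g s).
Proof.
move Em : m.+1 => m' df dg.
elim: df m Em => {m' f} [m'|m' c|m' f h _ IHf _ IHh|m' i f df IH] m.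
- by move=> _; apply: deg_lt_eq (deg_lt0 _) _ => s; rewrite mul0r.
- by move=> _; apply: deg_ltZ; apply: deg_ltW dg; rewrite ltnS leq_addl.
- move=> Em; apply: deg_lt_eq (deg_ltD (IHf _ Em) (IHh _ Em)) _ => s.
  by rewrite mulrDl.
- move=> [Em]; case: m => [|m] in Em *.
    apply: deg_lt_eq (deg_lt0 _) _ => s.
    by rewrite (deg_lt0P (f := f)) ?mulr0 ?mul0r // Em.
  by apply: deg_lt_eq (deg_ltX i (IH _ Em)) _ => s; rewrite mulrA.
Qed.

Lemma deg_ltXn m n f : deg_lt m.+1 f -> deg_lt (m * n).+1 (fun s => f s ^+ n).
Proof.
move=> df; elim: n => [|n IHn]; first by rewrite muln0; apply: deg_ltC.
by rewrite mulnS; apply: deg_lt_eq (deg_ltM df IHn) _ => s; rewrite exprS.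
Qed.

Lemma deg_lt_sum (I : Type) (r : seq I) m (f : I -> seq F -> F) :
  (forall i, deg_lt m (f i)) -> deg_lt m (fun s => \sum_(i <- r) f i s).
Proof.
move=> df; elim: r => [|i r IHr].
  by apply: deg_lt_eq (deg_lt0 m) _ => s; rewrite big_nil.
by apply: deg_lt_eq (deg_ltD (df i) IHr) _ => s; rewrite big_cons.
Qed.

Lemma deg_lt_prod (I : Type) (r : seq I) (d : I -> nat) (f : I -> seq F -> F) :
  (forall i, deg_lt (d i).+1 (f i)) ->
  deg_lt (\sum_(i <- r) d i).+1 (fun s => \prod_(i <- r) f i s).
Proof.
move=> df; elim: r => [|i r IHr].
  by apply: deg_lt_eq (deg_ltC _ 1) _ => s; rewrite big_nil.
rewrite big_cons.
by apply: deg_lt_eq (deg_ltM (df i) IHr) _ => s; rewrite big_cons.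
Qed.

Lemma deg_lt_nthX i n : deg_lt n.+1 (fun s => s`_i ^+ n).
Proof.
elim: n => [|n IHn]; first exact: deg_ltC.
by apply: deg_lt_eq (deg_ltX i IHn) _ => s; rewrite exprS.
Qed.

Lemma deg_lt_slice m f y : deg_lt m f -> deg_lt m (fun s => f (y :: s)).
Proof.
elim=> {m f} [m|m a|m f g _ IHf _ IHg|m [|i] f _ IH] /=; try by constructor.
by apply: deg_ltW (leqnSn m) _; apply: deg_ltZ.
Qed.

(** [h] is the divided difference in the first variable. For a factor [y] it obeys the Leibniz rule
    y f(y) - c f(c) = (y - c) (f(y) + c u(y)), with [u] the divided difference of [f]. *)
Lemma deg_lt_divdiff m f c : deg_lt m f ->
  exists2 h, deg_lt m.-1 h &
    forall y s, f (y :: s) = f (c :: s) + (y - c) * h (y :: s).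
Proof.
elim=> {m f} [m|m a|m f g _ [u du fu] _ [v dv gv]|m i f df [u du fu]].
- by exists (fun=> 0) => [|y s]; [constructor | rewrite mulr0 addr0].
- by exists (fun=> 0) => [|y s]; [constructor | rewrite mulr0 addr0].
- exists (fun s => u s + v s) => [|y s]; first by constructor.
  by rewrite fu gv; ring.
case: m => [|m] in df du *.
  exists (fun=> 0) => [|y s]; first by constructor.
  by rewrite !(deg_lt0P df) !mulr0 addr0.
case: i => [|i] /=.
  exists (fun s => f s + c * u s) => [|y s]; last by rewrite fu; ring.
  by apply: deg_ltD df _; apply: deg_ltZ; apply: deg_ltW du; apply: leqnSn.
by exists (fun s => s`_i.+1 * u s) => [|y s]; [apply: deg_ltX | rewrite fu /=; ring].
Qed.

(** Divided differences remove the hyperplanes one at a time. As [Z] has no repetitions, the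
    quotient still vanishes on those that remain. *)
Lemma deg_lt_factor n m f (Z : seq F) : uniq Z -> deg_lt m f ->
    (forall c (s : n.-tuple F), c \in Z -> f (c :: s) = 0) ->
  exists2 h, deg_lt (m - size Z) h & forall y (s : n.-tuple F),
    f (y :: s) = (\prod_(c <- Z) (y - c)) * h (y :: s).
Proof.
elim: Z m f => [|c Z IHZ] m f.
  by move=> _ df _; exists f => [|y s]; rewrite ?subn0 // big_nil mul1r.
move=> /= /andP[cZ uZ] df f0; have [u du fu] := deg_lt_divdiff c df.
have fE y (s : n.-tuple F) : f (y :: s) = (y - c) * u (y :: s).
  by rewrite fu f0 ?mem_head // add0r.
have [b s bZ|h dh uh] := IHZ _ _ uZ du.
  have /eqP := fE b s; rewrite f0 ?in_cons ?bZ ?orbT // eq_sym mulf_eq0 subr_eq0.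
  by case/orP=> /eqP // bc; rewrite -bc bZ in cZ.
exists h => [|y s]; first by rewrite subnS -subn1 subnAC subn1.
by rewrite fE uh big_cons mulrA.
Qed.

(** * Counting nonzeros of polynomial functions *)

Lemma card_nonzero_cons n f :
  #|[set s : n.+1.-tuple F | f s != 0]| =
  (\sum_(y : F) #|[set s : n.-tuple F | f (y :: s)%SEQ != 0%R]|)%N.
Proof.
pose h (ys : F * n.-tuple F) : n.+1.-tuple F := [tuple of ys.1 :: ys.2].
pose h' (s : n.+1.-tuple F) : F * n.-tuple F := (thead s, [tuple of behead s]).
have hK : cancel h h'.
  by case=> y s; rewrite /h /h' theadE /=; congr (_, _); apply: val_inj.
have hK' : cancel h' h.
  by move=> s; rewrite /h [RHS]tuple_eta; apply: val_inj.
rewrite -sum1_card (reindex h) /=; last by exists h' => s _.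
under eq_bigl do rewrite inE.
rewrite -(pair_big_dep xpredT (fun y (s : n.-tuple F) => f (y :: s) != 0)
  (fun=> fun=> 1%N)) /=.
by apply: eq_bigr => y _; rewrite -sum1_card; apply: eq_bigl => s; rewrite inE.
Qed.

(* With q = r + e + 1 this says q - e >= q ^ (1 - e / (q - 1)): concavity of
   q - e against convexity of the power, with equality at e = 0 and q - 1. *)
Lemma expn_le_concave r e : ((r + e).+1 ^ (r + e) <= r.+1 ^ (r + e) * (r + e).+1 ^ e)%N.
Proof.
have succ_expn N i : (i <= N)%N -> (N.+1 ^ i <= i.+1 * N ^ i)%N.
  elim: i => // i IHi lt_iN; rewrite !expnS.
  apply: leq_trans (leq_mul (leqnn _) (IHi (ltnW lt_iN))) _.
  by rewrite !mulnA leq_mul2r; nia.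
(* After cancelling [(r + e).+1 ^ e], induct on [e]: each step multiplies the left side by at most
   [r.+1]. *)
suff le_r : ((r + e).+1 ^ r <= r.+1 ^ (r + e))%N.
  by rewrite expnD leq_mul2r le_r orbT.
elim: e => [|e IHe]; first by rewrite addn0.
rewrite addnS expnS; apply: leq_trans (succ_expn _ _ _) _; first by lia.
by rewrite leq_mul2l IHe orbT.
Qed.

(** The bound q^(n - m/(q-1)), raised to the power q - 1 to keep exponents integral. *)
Lemma card_nonzero_deg_lt n m f (s0 : n.-tuple F) : deg_lt m.+1 f -> f s0 != 0 ->
  (#|F| ^ (n * #|F|.-1) <=
   #|[set s : n.-tuple F | f s != 0%R]| ^ #|F|.-1 * #|F| ^ m)%N.
Proof.
have F_gt0 : (0 < #|F|)%N by apply/card_gt0P; exists 0.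
elim: n m f s0 => [|n IHn] m f s0 df f_s0.
  rewrite mul0n muln_gt0 !expn_gt0 F_gt0 andbT.
  by apply/orP; left; apply/card_gt0P; exists s0; rewrite inE.
pose N y := #|[set s : n.-tuple F | f (y :: s)%SEQ != 0]|.
pose Z := [set y | N y == 0%N].
have ZP y (s : n.-tuple F) : y \in Z -> f (y :: s) = 0.
  rewrite inE cards_eq0 => /eqP/setP/(_ s); rewrite !inE.
  by move/negbT; rewrite negbK => /eqP.
have [|h dh fh] := @deg_lt_factor n m.+1 f (enum Z) (enum_uniq _) df.
  by move=> c s; rewrite mem_enum; apply: ZP.
rewrite -cardE in dh.
have [y0 [s1 s0E]] : exists y0 (s1 : n.-tuple F), s0 = y0 :: s1 :> seq F.
  by case/tupleP: s0 {f_s0} => y0 s1; exists y0, s1.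
(* More than [m] vanishing slices would leave a quotient of degree bound 0, so [f] would vanish. *)
have le_Zm : (#|Z| <= m)%N.
  rewrite leqNgt; apply: contraNN f_s0 => lt_mZ; rewrite s0E fh.
  by rewrite (deg_lt0P (f := h)) ?mulr0 //; move: dh; rewrite (eqP lt_mZ).
have z0Z : y0 \notin Z.
  by apply: contraNN f_s0 => /ZP fZ; rewrite s0E fZ.
have N_ge y : y \notin Z ->
    (#|F| ^ (n * #|F|.-1) <= N y ^ #|F|.-1 * #|F| ^ (m - #|Z|))%N.
  move=> yZ.
  have prodZ : \prod_(c <- enum Z) (y - c) != 0.
    rewrite prodf_seq_neq0; apply/allP => c; rewrite mem_enum => cZ /=.
    by rewrite subr_eq0; apply: contraNneq yZ => ->.
  have NE : N y = #|[set s : n.-tuple F | h (y :: s)%SEQ != 0]|.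
    by apply: eq_card => s; rewrite !inE fh mulf_eq0 (negPf prodZ).
  have : N y != 0%N by apply: contraNN yZ => Ny; rewrite inE.
  rewrite NE cards_eq0 => /set0Pn[s]; rewrite inE => hs.
  by apply: (IHn _ (fun s => h (y :: s)) s) => //; apply: deg_lt_slice; rewrite -subSn.
have [y yZ y_min] : exists2 y, y \notin Z & forall z, z \notin Z -> (N y <= N z)%N.
  by case: (@arg_minnP F y0 (fun y => y \notin Z) N z0Z) => y yZ my; exists y.
have le_sum : ((#|F| - #|Z|) * N y <= #|[set s : n.+1.-tuple F | f s != 0%R]|)%N.
  have -> : (#|F| - #|Z| = #|~: Z|)%N by rewrite [RHS]cardsCs finset.setCK.
  rewrite card_nonzero_cons -sum_nat_const [leqRHS](bigID (mem (~: Z))) /=.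
  apply: leq_trans (leq_addr _ _); apply: leq_sum => z.
  by rewrite finset.in_setC; apply: y_min.
have lt_ZF : (#|Z| < #|F|)%N.
  by rewrite -cardsT; apply: proper_card; apply/properP; split;
    [apply: finset.subsetT | exists y0].
have -> : (#|F| ^ m = #|F| ^ (m - #|Z|) * #|F| ^ #|Z|)%N by rewrite -expnD subnK.
apply: (@leq_trans (((#|F| - #|Z|) * N y) ^ #|F|.-1 *
  (#|F| ^ (m - #|Z|) * #|F| ^ #|Z|))%N);
  last first.
  by rewrite leq_mul2r leq_exp2r ?le_sum ?orbT // -subn1 subn_gt0 card_finNzRing_gt1.
(* With e = [#|Z|] this reads q^(q-1) <= (q-e)^(q-1) q^e: the drop of [e] in the degree compensates
   for the [e] vanishing slices. *)
have := expn_le_concave (#|F|.-1 - #|Z|) #|Z|.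
have -> : (#|F|.-1 - #|Z| + #|Z| = #|F|.-1)%N by lia.
have -> : ((#|F|.-1 - #|Z|).+1 = #|F| - #|Z|)%N by lia.
rewrite prednK // mulSn expnD expnMn => le1.
by have := leq_mul le1 (N_ge y yZ); rewrite -!mulnA; congr (_ <= _)%N; ring.
Qed.

(** Chevalley's product of the factors 1 - f_i^(q-1) is the indicator of the common zeros and has
    degree at most q - 1 times the sum of the [d i]. The zero [s0] shows that it is not identically
    zero. *)
Lemma warning_second n k (d : 'I_k -> nat) (f : 'I_k -> seq F -> F) (s0 : n.-tuple F) :
  (forall i, deg_lt (d i).+1 (f i)) -> (forall i, f i s0 = 0) ->
  (#|F| ^ n <= #|[set s : n.-tuple F | [forall i, f i s == 0%R]]|
               * #|F| ^ (\sum_i d i))%N.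
Proof.
move=> df f0; pose q := #|F|.
have q_gt1 : (1 < q)%N by apply: card_finNzRing_gt1.
pose P (s : seq F) := \prod_i (1 - f i s ^+ q.-1).
have dP : deg_lt (\sum_i (d i * q.-1)%N).+1 P.
  apply: deg_lt_prod => i; apply: deg_ltD (deg_ltC _ _) _.
  have := deg_ltZ (-1) (deg_ltXn q.-1 (df i)).
  by move/deg_lt_eq; apply=> s; rewrite mulN1r.
have PE s : (P s != 0) = [forall i, f i s == 0].
  apply/prodf_neq0/forallP => [Ps i|fs i _]; last first.
    by rewrite (eqP (fs i)) expr0n -subn1 subn_eq0 leqNgt q_gt1 subr0 oner_eq0.
  apply: contraNT (Ps i isT) => fi; apply/eqP.
  suff -> : f i s ^+ q.-1 = 1 by rewrite subrr.
  apply: (mulfI fi); rewrite -exprS prednK ?(ltnW q_gt1) // mulr1.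
  exact: expf_card.
have /(card_nonzero_deg_lt dP) : P s0 != 0.
  by rewrite PE; apply/forallP => i; rewrite f0.
rewrite -big_distrl /= !expnM -expnMn leq_exp2r -?subn1 ?subn_gt0 //.
by under eq_finset do rewrite PE.
Qed.

End Warning.

Local Open Scope classical_set_scope.

(** * Formal power series *)

Section FpsTheory.
Variable R : comNzRingType.
Implicit Types (f g u v w : fps R).

Lemma fps_coef_sum (I : Type) (r : seq I) (P : pred I) (F : I -> fps R) n :
  (\sum_(i <- r | P i) F i) n = \sum_(i <- r | P i) F i n.
Proof. exact: (big_morph (fun f : fps R => f n)). Qed.

Lemma fps_coefMn f m n : (f *+ m) n = f n *+ m.
Proof. by elim: m => // m IHm; rewrite !mulrS -IHm. Qed.

Lemma fps_coef_natM m f n : (m%:R * f) n = m%:R * f n.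
Proof. by rewrite !mulr_natl fps_coefMn. Qed.

Lemma fps_coef1 n : (1 : fps R) n = (n == 0)%:R.
Proof. exact: coef1. Qed.

Lemma fps_coefD f g n : (f + g) n = f n + g n.
Proof. by []. Qed.

Lemma fps_coefB f g n : (f - g) n = f n - g n.
Proof. by []. Qed.

Lemma fps_coefM f g n : (f * g) n = \sum_(i < n.+1) f i * g (n - i)%N.
Proof. by []. Qed.

Lemma fps_coef_XnM d f n :
  (fps_poly 'X^d * f) n = if (n < d)%N then 0 else f (n - d)%N.
Proof.
transitivity (\sum_(i < n.+1) (i == d :> nat)%:R * f (n - i)%N).
  by apply: eq_bigr => i _; rewrite /= coefXn.
case: ltnP => [lt_nd|le_dn].
  rewrite big1 // => i _; rewrite (_ : _ == _ = false) ?mul0r //.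
  by apply/eqP => ei; move: (ltn_ord i); rewrite ei ltnS leqNgt lt_nd.
rewrite (bigD1 (Ordinal (n := n.+1) (m := d) _)) //= eqxx mul1r big1 ?addr0 // => i.
by rewrite -val_eqE /= => /negPf ->; rewrite mul0r.
Qed.

Lemma fps_coef_expr_gt w m n : w 0 = 0 -> (n < m)%N -> (w ^+ m) n = 0.
Proof.
move=> w0; elim: m n => // m IHm n lt_nm; rewrite exprS fps_coefM.
rewrite big1 // => [[[|i] lt_in]] _ /=; first by rewrite w0 mul0r.
by rewrite IHm ?mulr0 //; lia.
Qed.

(** Geometric series: [w], equal to 1 - c u, has no constant term, so the inverse is [c] times the
    sum of the powers of [w], and coefficient [n] only involves powers up to [n]. *)
Lemma fps_unit u c : c * u 0 = 1 -> exists v, u * v = 1.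
Proof.
move=> cu; pose w := 1 - fps_poly c%:P * u.
have w0 : w 0 = 0.
  by rewrite /w fps_coefB fps_coefM big_ord1 fps_coef1 /= coefC /= cu subrr.
pose v n := fps_poly c%:P * \sum_(j < n.+1) w ^+ j.
have v_stable n m : (n <= m)%N -> v m n = v n n.
  move=> le_nm; rewrite /v !fps_coefM; apply: eq_bigr => i _; congr (_ * _).
  rewrite !fps_coef_sum [RHS](big_ord_widen m.+1 (fun j => (w ^+ j) (n - i)%N)) ?ltnS //.
  rewrite [RHS]big_mkcond /=; apply: eq_bigr => j _; case: ltnP => // lt_nj.
  by rewrite fps_coef_expr_gt // (leq_ltn_trans (leq_subr _ _)).
exists (Fps (fun n => v n n)); apply: fps_ext => n.
transitivity ((u * v n) n).
  rewrite !fps_coefM; apply: eq_bigr => i _; congr (_ * _).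
  exact: (esym (v_stable _ _ (leq_subr _ _))).
rewrite /v mulrA [u * _]mulrC (_ : _ * u = 1 - w); last by rewrite /w; ring.
rewrite -opprB mulNr -subrX1 opprB.
by rewrite fps_coefB fps_coef_expr_gt ?subr0.
Qed.

End FpsTheory.

(** * The l-adic integers and Weierstrass preparation *)

Section Padic.
Variable l : nat.
Hypothesis l_prime : prime l.
Implicit Types (x y z : padic l) (f g u v : fps (padic l)).

Let l_gt1 : (1 < l)%N := prime_gt1 l_prime.

Lemma Zp_pow_cast n : (Zp_trunc (l ^ n.+1)).+2 = (l ^ n.+1)%N.
Proof. by rewrite Zp_cast // (leq_ltn_trans _ (ltn_expl n.+1 l_gt1)). Qed.

Lemma ltn_approx x n : (x n < l ^ n.+1)%N.
Proof. by rewrite -[ltnRHS](Zp_pow_cast n) ltn_ord. Qed.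

Lemma approx_modn x m n : (n <= m)%N -> (x m %% l ^ n.+1)%N = x n :> nat.
Proof.
elim: m => [|m IHm].
  by rewrite leqn0 => /eqP ->; rewrite modn_small ?ltn_approx.
rewrite leq_eqVlt => /orP[/eqP->|le_nm]; first by rewrite modn_small ?ltn_approx.
rewrite -IHm // -[in RHS](approxP x m) /= (Zp_pow_cast m) modn_dvdm //.
by rewrite dvdn_exp2l.
Qed.

Lemma approxD_modn x y n : (x + y) n = ((x n + y n) %% l ^ n.+1)%N :> nat.
Proof. exact: (congr1 (modn _) (Zp_pow_cast n)). Qed.

Lemma approxM_modn x y n : (x * y) n = ((x n * y n) %% l ^ n.+1)%N :> nat.
Proof. exact: (congr1 (modn _) (Zp_pow_cast n)). Qed.

(** Level 0 lives in ['Z_(l ^ 1)]; the cast to ['F_l] provides the field structure. *)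
Definition res x : 'F_l := (x 0%N : nat)%:R.

Fact res_zmod_morphism : zmod_morphism res.
Proof.
have resD x y : res (x + y) = res x + res y.
  by rewrite /res approxD_modn; apply: etrans (Fp_nat_mod _ _) (natrD _ _ _).
by move=> x y; apply: (addIr (res y)); rewrite -resD !subrK.
Qed.

Fact res_monoid_morphism : monoid_morphism res.
Proof.
split=> [|x y]; first by rewrite /res /= modn_small.
by rewrite /res approxM_modn; apply: etrans (Fp_nat_mod _ _) (natrM _ _ _).
Qed.

HB.instance Definition _ := GRing.isZmodMorphism.Build _ _ res res_zmod_morphism.
HB.instance Definition _ := GRing.isMonoidMorphism.Build _ _ res res_monoid_morphism.

Lemma res_eq0 x : (res x == 0) = (x 0%N == 0%N :> nat).
Proof.
rewrite /res -(inj_eq val_inj) /= val_Fp_nat // modn_small //.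
exact: (ltn_approx x 0).
Qed.

Section OfNat.
Variable a : nat -> nat.
Hypothesis a_coherent : forall n, (a n.+1 = a n %[mod l ^ n.+1])%N.

Fact padic_of_nat_subproof n : Zp_red (inZp (a n.+1) : 'Z_(l ^ n.+2)) = inZp (a n).
Proof.
apply: val_inj => /=; rewrite !Zp_pow_cast modn_dvdm ?a_coherent //.
by rewrite dvdn_exp2l.
Qed.

Definition padic_of_nat : padic l := Padic padic_of_nat_subproof.

Lemma padic_of_natE n : padic_of_nat n = (a n %% l ^ n.+1)%N :> nat.
Proof. exact: (congr1 (modn _) (Zp_pow_cast n)). Qed.

End OfNat.

Lemma natr_padic_approx m n : ((m%:R : padic l) n = m %% l ^ n.+1 :> nat)%N.
Proof.
elim: m => [|m IHm]; first by rewrite mod0n.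
by rewrite -natr1 approxD_modn IHm modnDml -[in RHS]addn1; congr (modn (m + _) _).
Qed.

Lemma padic_natM_approx m x n : (m%:R * x) n = ((m * x n) %% l ^ n.+1)%N :> nat.
Proof. by rewrite approxM_modn natr_padic_approx modnMml. Qed.

Lemma padic_dvd_res x : padic_dvd x <-> res x = 0.
Proof.
split=> [[c ->]|/eqP]; first by rewrite rmorphM rmorph_nat // pchar_Fp_0 ?mul0r.
rewrite res_eq0 => /eqP x0.
have l_dvd n : (l %| x n)%N by apply/eqP; rewrite -x0 -(approx_modn x (leq0n n)) expn1.
(* Division by [l] costs one digit, so level [n] of the quotient is read from level [n.+1] of
   [x]. *)
have [y yE] : exists y : padic l, forall n, y n = (x n.+1 %/ l %% l ^ n.+1)%N :> nat.
  have coh n : (x n.+2 %/ l = x n.+1 %/ l %[mod l ^ n.+1])%N.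
    have l_gt0 : (0 < l)%N by apply: ltnW.
    apply/eqP; rewrite -(eqn_pmul2l l_gt0) !muln_modr -expnS !(mulnC l) !divnK //.
    by rewrite approx_modn // modn_small // ltn_approx.
  exists (padic_of_nat coh) => n; exact: padic_of_natE.
exists y; apply: padic_ext => n; apply: ord_inj; rewrite padic_natM_approx yE.
have -> : (x n.+1 %/ l %% l ^ n.+1 = x n.+1 %/ l)%N.
  by rewrite modn_small // ltn_divLR ?(ltnW l_gt1) // -expnSr ltn_approx.
by rewrite mulnC divnK // approx_modn.
Qed.

(** Multiplication by [l] gains one level of precision, which is what makes the iteration for
    Weierstrass preparation converge. *)
Lemma approx_natlMS x n : (l%:R * x) n.+1 = (l * x n)%N :> nat.
Proof.
by rewrite padic_natM_approx -[in RHS](approx_modn x (leqnSn n)) muln_modr -expnS.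
Qed.

Lemma approx_natlM0 x : (l%:R * x) 0%N = 0.
Proof.
by apply: ord_inj; rewrite padic_natM_approx; apply: modnMr.
Qed.

(** Every [x n] is prime to [l], hence invertible; uniqueness of inverses makes them coherent. *)
Lemma padic_unit x : res x != 0 -> exists y, x * y = 1.
Proof.
rewrite res_eq0 => x0.
have x_unit n : x n \is a GRing.unit.
  rewrite -[x n]natr_Zp unitZpE; last first.
    by rewrite (leq_ltn_trans _ (ltn_expl n.+1 l_gt1)).
  rewrite coprimeXl // prime_coprime // /dvdn.
  by have -> : (x n %% l = x 0)%N := approx_modn x (leq0n n).
have coh n : Zp_red (x n.+1)^-1 = (x n)^-1.
  apply: (mulrI (x_unit n)); rewrite (divrr (x_unit n)).
  by rewrite -{1}(approxP x n) -Zp_redM (divrr (x_unit n.+1)) Zp_red1.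
exists (Padic coh); apply: padic_ext => n; exact: (divrr (x_unit n)).
Qed.

Lemma padic_lim (z : nat -> padic l) : (forall n, z n.+1 n = z n n) ->
  exists x, forall n, x n = z n n.
Proof.
move=> z_stable; have coh n : Zp_red (z n.+1 n.+1) = z n n.
  by rewrite approxP.
by exists (Padic coh).
Qed.

Lemma approx_sum (I : Type) (r : seq I) (F : I -> padic l) n :
  (\sum_(i <- r) F i) n = \sum_(i <- r) F i n.
Proof. exact: (big_morph (fun x : padic l => x n)). Qed.

(* Levelwise, f |-> 1 - l * Phi f is a contraction for the l-adic distance. *)
Lemma fps_contraction (Phi : fps (padic l) -> fps (padic l)) :
    (forall n f g, (forall i, f i n = g i n) -> forall i, Phi f i n = Phi g i n) ->
  exists f, f = 1 - l%:R * Phi f.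
Proof.
move=> Phi_local; pose step f := 1 - l%:R * Phi f.
have stepE f i n : step f i n = fps_coef (1 : fps (padic l)) i n - (l%:R * Phi f i) n.
  by rewrite /step fps_coefB fps_coef_natM.
have step0 f g i : step f i 0%N = step g i 0%N by rewrite !stepE !approx_natlM0.
have stepS n f g : (forall i, f i n = g i n) -> forall i, step f i n.+1 = step g i n.+1.
  move=> fg i; rewrite !stepE; congr (_ - _).
  by apply: ord_inj; rewrite !approx_natlMS (Phi_local n f g).
pose z n := iter n step 1.
(* Level 0 is unaffected by [step] because [l] kills it, and each application of [step] carries
   agreement one level up. *)
have z_stable n i : z n.+1 i n = z n i n.
  elim: n i => [|n IHn] i; last exact: stepS.
  by rewrite (stepE 1) approx_natlM0 subr0.
have /choice[F FE] i : exists x : padic l, forall n, x n = z n i n.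
  exact: (padic_lim (z := fun n => z n i)).
exists (Fps F); apply: fps_ext => i; apply: padic_ext => n.
change (F i n = step (Fps F) i n); rewrite FE; case: n => [|n].
  by rewrite (stepE (Fps F)) approx_natlM0 subr0.
by apply: stepS => j; rewrite /= FE.
Qed.

(** Write f = l P + T^d U with [V] inverse to [U]. For q = Z V one gets q f = l Z V P + T^d Z, which
    is a monic polynomial of degree [d] once Z = 1 - l Phi(Z), where [Phi] takes the part of Z V P
    from degree [d] on. The contraction yields such a [Z]; its constant term is 1 modulo [l], so [q]
    is a unit. *)
Lemma weierstrass_exists f d :
    (forall i, (i < d)%N -> res (f i) = 0) -> res (f d) != 0 ->
  exists (g : {poly padic l}) u, weierstrass f (0%N, g, u).
Proof.
move=> f_lt /padic_unit[c cf].
have /choice[p pE] i : exists y, (i < d)%N -> f i = l%:R * y.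
  case: (ltnP i d) => [/f_lt/padic_dvd_res[y ->]|_]; [by exists y | by exists 0].
pose P := Fps (fun i => if (i < d)%N then p i else 0).
pose U := Fps (fun i => f (d + i)%N).
have fE : f = l%:R * P + fps_poly 'X^d * U.
  apply: fps_ext => i.
  rewrite fps_coefD fps_coef_natM fps_coef_XnM /=; case: ltnP => [/pE ->|le_di].
    by rewrite addr0.
  by rewrite mulr0 add0r subnKC.
have [|V UV] := @fps_unit _ U c; first by rewrite /= addn0 mulrC.
pose Phi Z := Fps (fun i => (Z * (V * P)) (d + i)%N).
have [|Z ZE] := @fps_contraction Phi.
  move=> n F G FG i; change ((F * (V * P)) (d + i)%N n = (G * (V * P)) (d + i)%N n).
  rewrite !fps_coefM !approx_sum.
  by apply: eq_bigr => j _; rewrite /= FG.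
pose q := Z * V.
have qfE : q * f = l%:R * (Z * (V * P)) + fps_poly 'X^d * Z.
  rewrite fE /q -[fps_poly _ * Z in RHS]mulr1 -[X in _ = _ + _ * X]UV; ring.
have qf_coef i : (q * f) i = l%:R * (Z * (V * P)) i + (fps_poly 'X^d * Z) i.
  by rewrite qfE fps_coefD fps_coef_natM.
have Z_coef i : Z i = (i == 0%N)%:R - l%:R * (Z * (V * P)) (d + i)%N.
  by rewrite {1}ZE fps_coefB fps_coef1 fps_coef_natM.
have qf_ge i : (d <= i)%N -> (q * f) i = (i == d)%:R.
  move=> le_di; rewrite qf_coef fps_coef_XnM ltnNge le_di /= Z_coef subnKC //.
  by rewrite addrC subrK subn_eq0 eqn_leq le_di andbT.
pose g := \poly_(i < d.+1) (q * f) i.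
have g_coef i : g`_i = (q * f) i.
  rewrite coef_poly ltnS; case: leqP => // lt_di.
  by rewrite qf_ge ?(ltnW lt_di) // gtn_eqF.
have size_g : size g = d.+1.
  by rewrite size_poly_eq // qf_ge // eqxx oner_neq0.
have resZ0 : res (Z 0%N) != 0.
  rewrite Z_coef rmorphB rmorph1 rmorphM rmorph_nat pchar_Fp_0 // mul0r subr0.
  exact: oner_neq0.
have [a Za] := padic_unit resZ0.
have [W ZW] := fps_unit (etrans (mulrC a _) Za).
have qUW : q * (U * W) = 1.
  transitivity (U * V * (Z * W)); first by rewrite /q; ring.
  by rewrite UV ZW mulr1.
exists g, (U * W); split.
- split; first by rewrite monicE lead_coefE size_g g_coef qf_ge ?eqxx.
  move=> i; rewrite size_g => lt_id; rewrite g_coef qf_coef fps_coef_XnM lt_id addr0.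
  by eexists.
- by exists q; rewrite mulrC.
have -> : fps_poly g = q * f by apply: fps_ext => i; rewrite -g_coef.
by rewrite expn0 mul1r [q * f]mulrC -mulrA qUW mulr1.
Qed.

(** Modulo [l], a distinguished polynomial is its leading monomial, and the constant term of [u]
    stays nonzero. *)
Lemma weierstrass_res f m (g : {poly padic l}) u : weierstrass f (m, g, u) ->
  [/\ forall i, (i < (size g).-1)%N -> res (f i) = 0,
      m = 0%N -> res (f (size g).-1) != 0
    & (0 < m)%N -> forall i, res (f i) = 0].
Proof.
case=> -[g_monic g_dvd] [v uv] fE.
have u0 : res (u 0%N) != 0.
  have /(congr1 (fun w : fps (padic l) => res (w 0%N))) := uv.
  rewrite fps_coefM big_ord1 fps_coef1 rmorphM rmorph1 /= => uv0.
  by apply: contra_eq_neq uv0 => ->; rewrite mul0r eq_sym oner_neq0.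
have fcoef i : res (f i) = (l ^ m)%:R * \sum_(j < i.+1) res g`_j * res (u (i - j)%N).
  rewrite fE -mulrA fps_coef_natM rmorphM rmorph_nat fps_coefM rmorph_sum.
  by congr (_ * _); apply: eq_bigr => j _; rewrite rmorphM.
have g_res i : (i < (size g).-1)%N -> res g`_i = 0 by move=> /g_dvd/padic_dvd_res.
split=> [i lt_i|m0|m_gt0 i].
- rewrite fcoef big1 ?mulr0 // => j _; rewrite g_res ?mul0r //.
  exact: leq_ltn_trans (ltnSE (ltn_ord j)) lt_i.
- rewrite fcoef m0 expn0 mul1r big_ord_recr big1 /= => [|j _];
    last by rewrite g_res ?mul0r.
  by rewrite add0r subnn -lead_coefE (monicP g_monic) rmorph1 mul1r.
- by rewrite fcoef -(prednK m_gt0) expnS natrM pchar_Fp_0 // !mul0r.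
Qed.

Lemma fps_mu0P f N : (fps_mu f = 0%N /\ (fps_deg f < N)%N) <->
  (exists2 d, (d < N)%N & res (f d) != 0).
Proof.
split.
  rewrite /fps_mu /fps_deg /weierstrass_dec; case: xgetP => [[[m g] u] _ wf|_] /=.
    move=> [m0 lt_gN]; exists (size g).-1 => //.
    by have [_ /(_ m0)] := weierstrass_res wf.
  (* The default value of [weierstrass_dec] has mu = 1. *)
  by case.
move=> exd; have [d res_fd d_min] : exists2 d, res (f d) != 0 &
    forall i, res (f i) != 0 -> (d <= i)%N.
  have exd' : exists d, res (f d) != 0 by case: exd => d _; exists d.
  by case: (ex_minnP exd') => d; exists d.
have [|g [u wf]] := @weierstrass_exists f d _ res_fd.
  by move=> i; apply: contraTeq => /d_min; rewrite -leqNgt.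
(* The chosen decomposition may differ from the one just built; its invariants are recovered from
   [weierstrass_res]. *)
have := @xgetI _ (1%N, 1, 1) _ _ wf; rewrite -/(weierstrass_dec f).
rewrite /fps_mu /fps_deg.
case: (weierstrass_dec f) => [[m h] v] /= /weierstrass_res[h_lt _ m_gt0].
have m0 : m = 0%N.
  by apply: contraNeq res_fd; rewrite -lt0n => /m_gt0 ->.
split=> //; case: exd => i lt_iN /d_min le_di; apply: leq_ltn_trans lt_iN.
apply: leq_trans le_di; rewrite leqNgt; apply: contraNN res_fd => /h_lt ->.
exact: eqxx.
Qed.

(** * Binomial coefficients modulo l *)

Lemma natr_Fp_neq0 n : (0 < n < l)%N -> n%:R != 0 :> 'F_l.
Proof.
case/andP=> n_gt0 lt_nl; rewrite -(inj_eq val_inj) /= val_Fp_nat // modn_small //.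
by rewrite -lt0n.
Qed.

Lemma fact_Fp_neq0 n : (n < l)%N -> n`!%:R != 0 :> 'F_l.
Proof.
elim: n => [|n IHn] lt_nl; first exact: oner_neq0.
by rewrite factS natrM; apply: mulf_neq0;
  [apply: natr_Fp_neq0 | apply: IHn; apply: ltnW].
Qed.

(** For n < l the factorial is a unit, so the quotient defining [padic_bin] exists and its defining
    identity can be reduced. *)
Lemma res_bin (b : padic l) n : (n < l)%N ->
  n`!%:R * res (padic_bin b n) = \prod_(i < n) (res b - i%:R).
Proof.
move=> lt_nl; pose prd : padic l := \prod_(i < n) (b - i%:R).
have [|y fy] := @padic_unit n`!%:R; first by rewrite rmorph_nat fact_Fp_neq0.
have /(xgetI 0) : [set c | n`!%:R * c = prd] (y * prd) by rewrite /= mulrA fy mul1r.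
rewrite /= -/(padic_bin b n) => /(congr1 res).
rewrite rmorphM rmorph_nat rmorph_prod => ->.
by apply: eq_bigr => i _; rewrite rmorphB rmorph_nat.
Qed.

(** * The characteristic series of a bouquet *)

Section Bouquet.
Variables (t : nat) (alpha : 'rV[padic l]_t).

Definition res_power_sum i : 'F_l := \sum_(j < t) res (alpha 0 j) ^+ i.

Let falling d : {poly 'F_l} := \prod_(i < d) ('X - i%:R%:P).

Let hornerE_falling d (x : 'F_l) : (falling d).[x] = \prod_(i < d) (x - i%:R).
Proof. by rewrite horner_prod; apply: eq_bigr => i _; rewrite hornerXsubC. Qed.

Let size_falling d : size (falling d) = d.+1.
Proof. by rewrite size_prod_XsubC /index_enum -enumT size_enum_ord. Qed.

Lemma res_bouquet_coef0 : res (bouquet_series alpha 0%N) = 0.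
Proof.
have bin0 (b : padic l) : res (padic_bin b 0) = 1.
  by have := @res_bin b 0 (ltnW l_gt1); rewrite mul1r big_ord0.
rewrite fps_coef_sum rmorph_sum big1 // => j _.
rewrite !fps_coefB fps_coefMn fps_coef1 !rmorphB rmorphMn rmorph1 /= !bin0; ring.
Qed.

(* Only even powers occur, since the summand attached to a voltage is even in it. *)
Lemma res_bouquet_coef d : (0 < d < l)%N ->
    (forall i, (0 < i)%N -> (i.*2 < d)%N -> res_power_sum i.*2 = 0) ->
  d`!%:R * res (bouquet_series alpha d) = - ((1 + (-1) ^+ d) * res_power_sum d).
Proof.
case/andP=> d_gt0 lt_dl S0.
transitivity (- \sum_(j < t)
    ((falling d).[res (alpha 0 j)] + (falling d).[- res (alpha 0 j)])).
  rewrite fps_coef_sum rmorph_sum mulr_sumr -sumrN; apply: eq_bigr => j _.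
  rewrite !fps_coefB fps_coefMn fps_coef1 gtn_eqF // mul0rn !rmorphB rmorph0 /=.
  by rewrite sub0r !mulrDr !mulrN !res_bin // !hornerE_falling rmorphN opprD.
congr (- _).
transitivity (\sum_(i < d.+1) (falling d)`_i * ((1 + (-1) ^+ i) * res_power_sum i)).
  rewrite /res_power_sum; under [RHS]eq_bigr do rewrite !mulr_sumr.
  rewrite exchange_big; apply: eq_bigr => j _.
  rewrite !(@horner_coef_wide _ d.+1) ?size_falling // -big_split.
  apply: eq_bigr => i _ /=.
  by rewrite (exprNn (res _)); ring.
(* Only the leading term survives: odd [i] cancel by sign, [i = 0] because 0 is a root of
   [falling d], and even positive [i] by [S0]. *)
rewrite big_ord_recr /= big1 ?add0r => [|[i lt_id] _ /=].
  have : lead_coef (falling d) = 1 by apply/monicP; apply: monic_prod_XsubC.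
  by rewrite lead_coefE size_falling => ->; rewrite mul1r.
have [i_odd|i_even] := boolP (odd i).
  by rewrite -signr_odd i_odd expr1 subrr mul0r mulr0.
case: (posnP i) => [->|i_gt0].
  rewrite -horner_coef0 hornerE_falling (bigD1 (Ordinal d_gt0)) //= subrr.
  by rewrite !mul0r.
have i_half : i./2.*2 = i by rewrite -[RHS]odd_double_half (negPf i_even).
by rewrite -i_half S0 ?i_half ?mulr0 // half_gt0; case: (i) i_gt0 i_even => [|[]].
Qed.

(** The system is triangular: once the lower even power sums vanish, coefficient [d] is a unit
    multiple of the [d]-th power sum for even positive [d], and zero for odd [d]. The bound on [k]
    keeps the factorials invertible. *)
Lemma res_bouquet_neq0P k : odd l -> (k.*2 <= l)%N ->
  (exists2 d, (d < k.*2)%N & res (bouquet_series alpha d) != 0) <->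
  (exists i : 'I_k.-1, res_power_sum i.+1.*2 != 0).
Proof.
move=> l_odd le_kl; split=> [[d lt_dk]|[i]]; apply: contra_neqP.
  move=> /forallNP S0; case: (posnP d) => [->|d_gt0]; first exact: res_bouquet_coef0.
  have {}S0 i : (0 < i < k)%N -> res_power_sum i.*2 = 0.
    case: i => // i /= lt_ik.
    have lt_ik' : (i < k.-1)%N by lia.
    by apply/eqP/negPn/negP => /(S0 (Ordinal lt_ik')).
  have lt_dl := leq_trans lt_dk le_kl.
  apply: (mulfI (fact_Fp_neq0 lt_dl)); rewrite mulr0 res_bouquet_coef ?d_gt0 //.
    have [d_odd|d_even] := boolP (odd d).
      by rewrite -signr_odd d_odd expr1 subrr mul0r oppr0.
    have d_half : d./2.*2 = d by rewrite -[RHS]odd_double_half (negPf d_even).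
    by rewrite -d_half S0 ?mulr0 ?oppr0 //; lia.
  by move=> i i_gt0 lt_id; apply: S0; lia.
move=> f0; have {}f0 d : (d < k.*2)%N -> res (bouquet_series alpha d) = 0.
  by move=> lt_dk; apply/eqP/negPn/negP => fd; apply: f0; exists d.
suff S0 n : (0 < n < k)%N -> res_power_sum n.*2 = 0
  by apply: S0; have := ltn_ord i; lia.
elim/ltn_ind: n => n IHn n_lt.
have lt_nl : (0 < n.*2 < l)%N by lia.
have S_lt m : (0 < m)%N -> (m.*2 < n.*2)%N -> res_power_sum m.*2 = 0.
  by move=> m_gt0 lt_mn; apply: IHn; lia.
have /esym/eqP := res_bouquet_coef lt_nl S_lt; rewrite f0; last by lia.
rewrite -signr_odd odd_double mulr0 oppr_eq0 mulf_eq0 => /orP[|/eqP //].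
(* The factor 1 + (-1)^(2n) is 2, which is nonzero because [l] is odd. *)
by rewrite -[1 + _]/(2%:R) (negPf (natr_Fp_neq0 _)) //; lia.
Qed.

(** The shift by -1 in lambda turns the bound into degree less than 2k. Admissibility comes from the
    nonzero power sum: voltages all divisible by [l] would make every such sum vanish. *)
Lemma bouquet_eventP k : odd l -> (k.*2 <= l)%N ->
  [/\ admissible alpha, mu_bouquet alpha = 0%N
    & lambda_bouquet alpha < 2 * k%:Z - 1] <->
  exists i : 'I_k.-1, res_power_sum i.+1.*2 != 0.
Proof.
move=> l_odd le_kl; rewrite -res_bouquet_neq0P // -fps_mu0P.
have -> : (lambda_bouquet alpha < 2 * k%:Z - 1) =
    (fps_deg (bouquet_series alpha) < k.*2)%N.
  by rewrite /lambda_bouquet; lia.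
split=> [[]//|mu_deg]; split; try by case: mu_deg.
move=> alpha_dvd; move: mu_deg; rewrite fps_mu0P res_bouquet_neq0P //.
case=> i /eqP; apply; rewrite /res_power_sum big1 // => j _.
by have /padic_dvd_res -> := alpha_dvd j; rewrite expr0n.
Qed.

End Bouquet.

(** * Haar measure of residue classes *)

Section ResidueMeasure.
Variables (R : realType) (t : nat).
Variable tau : {measure set (borelType 'rV[padic l]_t) -> \bar R}.
Hypothesis tau_haar : normalized_haar tau.

Definition res_row (alpha : 'rV[padic l]_t) : t.-tuple 'F_l :=
  [tuple res (alpha 0 j) | j < t].

Lemma open_approx_eq n (a : 'Z_(l ^ n.+1)) : open [set x : padic l | x n = a].
Proof.
pose pr : prod_topology (fun n => discrete_topology 'Z_(l ^ n.+1)) -> _ := proj n.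
exists (pr @^-1` [set a]) => //.
apply: open_comp; last exact: discrete_open.
by move=> x _; apply: proj_continuous.
Qed.

(** Residue classes are cut out by level 0 of each entry, so they are products of open cylinders. *)
Lemma open_res_row (A : set (t.-tuple 'F_l)) : open (res_row @^-1` A).
Proof.
rewrite openE => alpha Aalpha.
exists (fun i j => [set x : padic l | x 0%N = alpha i j 0%N]) => [i j|beta ab].
  by apply: open_nbhs_nbhs; split=> //; exact: open_approx_eq.
suff e : res_row beta = res_row alpha by rewrite /preimage /= e.
by apply: eq_from_tnth => j; rewrite !tnth_mktuple /res ab.
Qed.

Lemma measurable_res_row A :
  measurable (res_row @^-1` A : set (borelType 'rV[padic l]_t)).
Proof. by apply: sub_sigma_algebra; apply: open_res_row. Qed.

(** A lift of [v] by natural numbers puts the fibre in the form to which translation invariance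
    applies. *)
Lemma res_row_fibre (v : t.-tuple 'F_l) :
  res_row @^-1` [set v] = [set (\row_j (tnth v j : nat)%:R) + a |
    a in res_row @^-1` [set [tuple 0 | j < t]]].
Proof.
have res_lift j : res ((tnth v j : nat)%:R : padic l) = tnth v j.
  by rewrite rmorph_nat natr_Zp.
apply/seteqP; split=> [alpha /= av|_ [a /= a0 <-]].
  exists (alpha - \row_j (tnth v j : nat)%:R); last by rewrite addrC subrK.
  apply: eq_from_tnth => j; rewrite !tnth_mktuple !mxE raddfB /= res_lift -av.
  by rewrite tnth_mktuple subrr.
apply: eq_from_tnth => j; rewrite !tnth_mktuple !mxE raddfD /= res_lift.
have /(congr1 (fun w => tnth w j)) := a0; rewrite !tnth_mktuple => ->.
by rewrite addr0.
Qed.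

(** The l^t fibres share one measure [c] by invariance, and total mass 1 forces c = l^(-t). *)
Lemma haar_res_row (A : {set t.-tuple 'F_l}) :
  tau (res_row @^-1` [set` A]) = (#|A|%:R / l%:R ^+ t)%:E.
Proof.
pose c := tau (res_row @^-1` [set [tuple 0 | j < t]]).
have [tau1 tau_inv] := tau_haar.
have tau_fibre (v : t.-tuple 'F_l) : tau (res_row @^-1` [set v]) = c.
  by rewrite res_row_fibre; apply: tau_inv; apply: measurable_res_row.
have c_fin : c \is a fin_num.
  rewrite ge0_fin_numE ?measure_ge0 //; apply: (@le_lt_trans _ _ (tau setT)).
    by apply: le_measure => //; rewrite inE;
      [apply: measurable_res_row | apply: measurableT].
  by rewrite tau1 ltry.
have tauE (B : {set t.-tuple 'F_l}) :
    tau (res_row @^-1` [set` B]) = (#|B|%:R * fine c)%:E.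
  have -> : res_row @^-1` [set` B] = \bigcup_(v in [set` enum B]) res_row @^-1` [set v].
    apply/seteqP; split=> [a /= aB|a [v /= vB ->]]; last by rewrite mem_enum in vB.
    by exists (res_row a) => //=; rewrite mem_enum.
  rewrite measure_fin_bigcup //; last first.
  - by move=> v _; apply: measurable_res_row.
  - by move=> v w _ _ [a [/= <- <-]].
  rewrite -fsbig_seq ?enum_uniq //.
  rewrite (eq_bigr (fun=> (fine c)%:E)) => [|v _];
    last by rewrite fineK //; exact: tau_fibre.
  by rewrite sumEFin big_const_seq count_predT -cardE iter_addr_0 mulr_natl.
have := tauE [set: t.-tuple 'F_l]%SET; rewrite (_ : _ @^-1` _ = setT); last first.
  by apply/seteqP; split=> // a _; rewrite /= inE.
rewrite tau1 cardsT card_tuple card_Fp // natrX => -[c1].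
have l_neq0 : (l%:R : R) ^+ t != 0.
  by rewrite expf_neq0 // pnatr_eq0 -lt0n prime_gt0.
rewrite tauE; congr (_ * _)%:E; apply: (mulfI l_neq0).
by rewrite -c1 divff.
Qed.

End ResidueMeasure.

End Padic.

(** * From the count of common zeros to the probability *)

Theorem theorem4p16 (R : realType) (l t k : nat)
    (tau : {measure set (borelType 'rV[padic l]_t) -> \bar R}) :
  prime l -> odd l -> (2 <= t)%N -> (1 < k)%N ->
  (2 * k - 1 < l)%N -> (k * (k - 1) < t)%N ->
  normalized_haar tau ->
  (Prob_bouquet tau 0 (2 * k%:Z - 1)
    <= ((1 - l%:R ^- t)^-1 * (1 - l%:R ^- (k * (k - 1))))%:E)%E.
Proof.
move=> l_prime l_odd t_ge2 k_gt1 lt_kl _ haar.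
have le_kl : (k.*2 <= l)%N by lia.
pose f (i : 'I_k.-1) (s : seq 'F_l) := \sum_(j < t) s`_j ^+ i.+1.*2.
pose V := [set s : t.-tuple 'F_l | [forall i, f i s == 0]]%SET.
have l_gt1 := prime_gt1 l_prime.
have V_ge : (l ^ t <= #|V| * l ^ (k * (k - 1)))%N.
  (* The total degree 2 + 4 + ... + (2k - 2) of the power sums. *)
  have -> : (k * (k - 1) = \sum_(i < k.-1) i.+1.*2)%N.
    case: k k_gt1 {lt_kl le_kl f V} => // k _; rewrite subn1 /=.
    elim: k => [|k IHk]; first by rewrite big_ord0.
    by rewrite big_ord_recr /= -IHk; lia.
  have := @warning_second _ t k.-1 (fun i => i.+1.*2) f [tuple 0 | j < t].
  rewrite card_Fp //; apply.
    by move=> i; apply: deg_lt_sum => j; apply: deg_lt_nthX.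
  by move=> i; rewrite /f big1 // => j _; rewrite -tnth_nth tnth_mktuple expr0n.
have eventE : [set alpha : 'rV[padic l]_t | [/\ admissible alpha,
    mu_bouquet alpha = 0%N & lambda_bouquet alpha < 2 * k%:Z - 1]] =
    @res_row l t @^-1` [set` ~: V].
  have fE (alpha : 'rV[padic l]_t) i : f i (res_row alpha) = res_power_sum alpha i.+1.*2.
    by rewrite /f /res_power_sum; apply: eq_bigr => j _; rewrite -tnth_nth tnth_mktuple.
  apply/seteqP; split=> alpha /=.
    case/(bouquet_eventP l_prime alpha l_odd le_kl) => i Si.
    by rewrite !inE; apply/forallPn; exists i; rewrite fE.
  rewrite !inE => /forallPn[i]; rewrite fE => Si.
  by apply/(bouquet_eventP l_prime alpha l_odd le_kl); exists i.
rewrite /Prob_bouquet eventE haar_res_row // -EFinM lee_fin.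
have l_gt0 : (0 : R) < l%:R by rewrite ltr0n ltnW.
apply: ler_wpM2l.
  rewrite invr_ge0 subr_ge0 invf_le1 ?exprn_gt0 //.
  by rewrite exprn_ege1 // ler1n ltnW.
have -> : (#|~: V| = l ^ t - #|V|)%N.
  by rewrite cardsCs finset.setCK card_tuple card_Fp.
have le_V : (#|V| <= l ^ t)%N.
  by rewrite -[X in (_ <= X ^ _)%N](card_Fp l_prime) -card_tuple max_card.
rewrite natrB // natrX mulrBl divff ?expf_neq0 ?lt0r_neq0 //.
(* It remains that [V] has density at least l^(-k(k-1)), which is [V_ge] with denominators
   cleared. *)
rewrite lerB // ler_pdivlMr ?exprn_gt0 // mulrC ler_pdivrMr ?exprn_gt0 //.
by rewrite -!natrX -natrM ler_nat.
Qed.
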